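(* Let $d\ge4$, $\gamma>-1$, $1\le p\le d$, and let $k_1,\dots,k_5\in\{1,\dots,d+1\}$ be distinct. Put $$a=\frac{p-1}{2}\,\frac{m_{\{4,1\}}-m_{\{3,2\}}}{m_{\{3,1,1\}}-m_{\{2,2,1\}}}-1,$$ assume $a>0$ and $a\ne1$, and put $$A_6=\frac{m_{\{4,1\}}-m_{\{3,2\}}}{p\,a(a-1)^2(a+1)}.$$ Suppose that the following system holds with $A_1,\dots,A_5$ positive: \begin{align*} \sum_{j=1}^5A_jk_j+A_6(a^5+p)&=m_{\{5\}},\\ 2\sum_{j=1}^5A_j\binom{k_j}{2}+A_6\Big(a^4p+ap+2\binom p2\Big)&=m_{\{4,1\}},\\ 3\sum_{j=1}^5A_j\binom{k_j}{3}+A_6\Big((a^3+2a)\binom p2+3\binom p3\Big)&=m_{\{3,1,1\}},\\ 4\sum_{j=1}^5A_j\binom{k_j}{4}+A_6\Big((a^2+3a)\binom p3+4\binom p4\Big)&=m_{\{2,1,1,1\}},\\ \sum_{j=1}^5A_j\binom{k_j}{5}+A_6\Big(a\binom p4+\binom p5\Big)&=m_{\{1,1,1,1,1\}}. \end{align*} Then $$ w_\gamma\int_{\mathcal{T}^{d+1}}f(\xi)\xi^\gamma d\xi=\sum_{j=1}^5\frac{A_j}{\binom{d+1}{k_j}}\sum_{x\in v_{k_j}S_{d+1}}f(x)+\frac{A_6}{(d+1)\binom dp}\sum_{x\in u_{a,p}S_{d+1}}f(x) $$ is a positive cubature rule of index $5$, i.e. it holds for all homogeneous polynomials $f$ of degree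 $5$ in $d+1$ variables. Furthermore, with $\lambda_j=A_jk_j^5$ $(1\le j\le5)$ and $\lambda_6=A_6(a+p)^5$, the rule $$ w_\gamma\int_{\mathcal{T}^{d+1}}f(\xi)\xi^\gamma d\xi=\sum_{j=1}^5\frac{\lambda_j}{\binom{d+1}{k_j}}\sum_{x\in v_{k_j}S_{d+1}}f\Big(\frac x{k_j}\Big)+\frac{\lambda_6}{(d+1)\binom dp}\sum_{x\in u_{a,p}S_{d+1}}f\Big(\frac x{a+p}\Big) $$ is a positive cubature rule of index $5$ with all nodes in $\mathcal{T}^{d+1}$.
   Context: $T^d=\{x\in\mathbb{R}^d:x_i\ge0,\ |x|_1\le1\}$ with $|x|_1=x_1+\dots+x_d$, and $\mathcal{T}^{d+1}=\{\xi\in\mathbb{R}^{d+1}:\xi_i\ge0,\ \xi_1+\dots+\xi_{d+1}=1\}$; $\int_{\mathcal{T}^{d+1}}f(\xi)\xi^\gamma d\xi:=\int_{T^d}f(x,1-|x|_1)(x_1\cdots x_d(1-|x|_1))^\gamma dx$, and $w_\gamma$ is the constant making $w_\gamma\int_{\mathcal{T}^{d+1}}\xi^\gamma d\xi=1$. $v_k=(1,\dots,1,0,\dots,0)\in\mathbb{R}^{d+1}$ ($k$ ones); $u_{a,p}=(a,1,\dots,1,0,\dots,0)\in\mathbb{R}^{d+1}$ ($p$ ones after $a$); $yS_{d+1}$ is the set of distinct points obtained from $y$ by permuting coordinates. For a partition $\ell=(\ell_1\ge\dots\ge\ell_r>0)$, $S_{\{\ell\}}(x)$ is the monomial symmetric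 polynomial in $x_1,\dots,x_{d+1}$ (sum of all distinct monomials obtained from $x_1^{\ell_1}\cdots x_r^{\ell_r}$ by permuting variables), and $m_{\{\ell\}}=w_\gamma\int_{\mathcal{T}^{d+1}}S_{\{\ell\}}(\xi)\xi^\gamma d\xi$. A cubature rule is positive if all its weights are positive. *)

(* Defs.v *)
From HB Require Import structures.
From mathcomp Require Import all_boot all_order all_algebra all_fingroup.
(* The notations of mpoly cannot be loaded together with those of
   MathComp-Analysis; only its constants, coercions and instances are used. *)
From mathcomp Require Import -(notations) mpoly.
From mathcomp Require Import all_classical all_reals all_analysis.

Set Implicit Arguments.
Unset Strict Implicit.
Unset Printing Implicit Defensive.

Import Order.TTheory GRing.Theory Num.Theory.
Import numFieldNormedType.Exports.

Local Open Scope classical_set_scope.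
Local Open Scope ring_scope.

Section LebesgueTuple.
Variable R : realType.
Local Notation mR := (measurableTypeR R).

Definition cons_pair n (z : n.-tuple mR * mR) : n.+1.-tuple mR :=
  [the n.+1.-tuple mR of z.2 :: z.1].

Lemma measurable_cons_pair n : measurable_fun setT (@cons_pair n).
Proof.
apply: measurable_cons; [exact: measurable_snd|exact: measurable_fst].
Qed.

Section Step.
Variables (n : nat) (mu : {measure set (n.-tuple mR) -> \bar R}).

Definition lebesgue_step : set (n.+1.-tuple mR) -> \bar R :=
  pushforward (product_measure1 mu (@lebesgue_measure R)) (@cons_pair n).

Let mcons := @measurable_cons_pair n.

Let step0 : lebesgue_step set0 = 0%E.
Proof. exact: measure0. Qed.

Let step_ge0 B : (0 <= lebesgue_step B)%E.
Proof. exact: measure_ge0. Qed.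

Let step_sigma_additive : semi_sigma_additive lebesgue_step.
Proof. exact: measure_semi_sigma_additive. Qed.

HB.instance Definition _ := isMeasure.Build _ _ _ lebesgue_step
  step0 step_ge0 step_sigma_additive.
End Step.

(* Lebesgue measure on R^n with its product sigma-algebra, built one coordinate
   at a time; it is characterized by lebesgue_tuple_box. *)
Fixpoint lebesgue_tuple n : {measure set (n.-tuple mR) -> \bar R} :=
  match n with
  | 0 => dirac ([tuple] : 0.-tuple mR)
  | n'.+1 => lebesgue_step (lebesgue_tuple n')
  end.

Lemma measurable_box n (B : 'I_n -> set mR) :
  (forall i, measurable (B i)) ->
  measurable [set x : n.-tuple mR | forall i, B i (tnth x i)].
Proof.
move=> mB; rewrite (_ : [set _ | _] =
    \bigcap_i ((fun x : n.-tuple mR => tnth x i) @^-1` B i)).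
  apply: fin_bigcap_measurable => // i _.
  by rewrite -[X in measurable X]setTI; exact: measurable_tnth.
by apply/seteqP; split => x /= Bx i => [_|]; exact: Bx.
Qed.

Lemma lebesgue_tuple_box n (B : 'I_n -> set mR) :
  (forall i, measurable (B i)) ->
  lebesgue_tuple n [set x | forall i, B i (tnth x i)] =
  (\prod_(i < n) lebesgue_measure (B i))%E.
Proof.
elim: n B => [|n IH] B mB.
  by rewrite big_ord0 /= diracE mem_set// => -[].
rewrite big_ord_recl /= /lebesgue_step /pushforward.
pose C := [set x : n.-tuple mR | forall i, B (lift ord0 i) (tnth x i)].
rewrite (_ : _ @^-1` _ = C `*` B ord0); last first.
  apply/seteqP; split => -[x y] /=.
    move=> H; split; last by have := H ord0; rewrite tnth0.
    by move=> i; have := H (lift ord0 i); rewrite tnthS.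
  move=> [Cx By] i; case: (unliftP ord0 i) => [j ->|->].
    by rewrite tnthS; exact: Cx.
  by rewrite tnth0.
rewrite [LHS]product_measure1E//; last first.
  by apply: (@measurable_box n (fun i => B (lift ord0 i))) => i; exact: mB.
rewrite muleC; congr (_ * _)%E.
by apply: (IH (fun i => B (lift ord0 i))) => i; exact: mB.
Qed.

Lemma lebesgue_tuple_sigma_finite n : sigma_finite setT (lebesgue_tuple n).
Proof.
pose I (k : nat) : set mR := `[- k%:R, k%:R]%classic.
exists (fun k => [set x | forall i, I k (tnth x i)]).
  apply/seteqP; split => // x _.
  pose k := (\sum_(i < n) (Num.truncn `|tnth x i|).+1)%N.
  exists k => // i; rewrite /I /= in_itv /= -ler_norml.
  apply: le_trans (ltW (@truncnS_gt R _)) _; rewrite ler_nat.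
  by rewrite /k (bigD1 i)//= leq_addr.
have mI k (i : 'I_n) : measurable (I k) by exact: measurable_itv.
move=> k; split; first exact: (measurable_box (mI k)).
rewrite (lebesgue_tuple_box (mI k)) -ge0_fin_numE; last first.
  by apply: prode_ge0.
by apply: prode_fin_num => i _; rewrite lebesgue_measure_itv/=; case: ifP.
Qed.

End LebesgueTuple.

Section Simplex.
Variable R : realType.

(* T^d, inside R^d *)
Definition corner_simplex d : set (d.-tuple (measurableTypeR R)) :=
  [set x | (forall i, 0 <= tnth x i) /\ \sum_(i < d) tnth x i <= 1].

(* the standard simplex, inside R^n *)
Definition std_simplex n : set (n.-tuple R) :=
  [set x | (forall i, 0 <= tnth x i) /\ \sum_(i < n) tnth x i = 1].

(* x |-> (x, 1 - |x|_1), from T^d onto the standard simplex of R^(d+1) *)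
Definition simplex_lift d (x : d.-tuple R) : d.+1.-tuple R :=
  [tuple of rcons x (1 - \sum_(i < d) tnth x i)].

(* the integral of f(xi) xi^gamma over the standard simplex of R^(d+1) *)
Definition simplex_integral d (gamma : R) (f : d.+1.-tuple R -> R) : R :=
  \int[lebesgue_tuple R d]_(x in @corner_simplex d)
    (f (simplex_lift x) *
     (\prod_(i < d.+1) tnth (simplex_lift x) i) `^ gamma).

(* w_gamma: for gamma > -1 the integral below is finite and positive *)
Definition simplex_weight d (gamma : R) : R :=
  (simplex_integral gamma (fun _ : d.+1.-tuple R => 1))^-1.

Definition simplex_mean d (gamma : R) (f : mpoly d.+1 R) : R :=
  simplex_weight d gamma *
  simplex_integral gamma (fun xi => meval (tnth xi) f).

End Simplex.

(* the distinct tuples obtained from y by permuting its entries *)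
Definition perm_orbit (T : eqType) n (y : n.-tuple T) : seq (n.-tuple T) :=
  undup [seq [tuple tnth y (s i) | i < n] | s : 'S_n].

(* Monomial symmetric polynomial in n variables of the partition l
   (meaningful for size l <= n; missing parts are 0). *)
Definition monsym n (R : nzRingType) (l : seq nat) : mpoly n R :=
  \sum_(e <- perm_orbit [tuple nth 0%N l i | i < n]) mpolyX R (Multinom e).

Definition moment (R : realType) d (gamma : R) (l : seq nat) : R :=
  simplex_mean gamma (monsym d.+1 R l).

Section Nodes.
Variable R : realType.

(* (1, ..., 1, 0, ..., 0), with k ones *)
Definition vpt n k : n.-tuple R := [tuple ((i < k)%N)%:R | i < n].

(* (a, 1, ..., 1, 0, ..., 0), with p ones *)
Definition upt n (a : R) p : n.-tuple R :=
  [tuple if i == 0 :> nat then a else ((i <= p)%N)%:R | i < n].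

Definition tdiv n (x : n.-tuple R) (c : R) : n.-tuple R :=
  [tuple tnth x i / c | i < n].

(* A cubature rule is the list of its pairs (weight, node). *)
Definition rule n := seq (R * n.-tuple R).

Definition rule_sum n (Q : rule n) (f : mpoly n R) : R :=
  \sum_(q <- Q) q.1 * meval (tnth q.2) f.

Definition positive_cubature d (gamma : R) (t : nat) (Q : rule d.+1) : Prop :=
  (forall q, q \in Q -> 0 < q.1) /\
  (forall f : mpoly d.+1 R, f \is ishomog1 t mdeg ->
    simplex_mean gamma f = rule_sum Q f).

End Nodes.

(* Main.v *)
(* Both sides of a rule are linear in f and invariant under permutations of the
   coordinates, hence on degree 5 they are determined by their values on the
   seven monomial symmetric polynomials.  Five of these are the equations of the
   system; the definition of A_6 turns the equation of (4,1) into that of (3,2),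
   and the definition of a turns that of (3,1,1) into that of (2,2,1).  The sign
   of A_6 comes from
     x^4 y + x y^4 - x^3 y^2 - x^2 y^3 = x y (x + y) (x - y)^2 >= 0.
   For the invariance of the integral, the map x_i |-> 1 - |x|_1 preserves
   Lebesgue measure on T^d and exchanges the i-th and the last barycentric
   coordinates; such transpositions generate the symmetric group.  For its
   finiteness, some coordinate is at least 1 / (d + 1), and by symmetry it may
   be taken to be the last one, so that the density is dominated by a product of
   integrable functions of one variable. *)
Require Import Defs.
From HB Require Import structures.
From mathcomp Require Import all_boot all_order all_algebra all_fingroup.
From mathcomp Require Import -(notations) mpoly.
From mathcomp Require Import all_classical all_reals all_analysis.
From mathcomp Require Import measurable_realfun zify ring lra.

Set Implicit Arguments.
Unset Strict Implicit.
Unset Printing Implicit Defensive.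

Import Order.TTheory GRing.Theory Num.Theory.
Import numFieldNormedType.Exports.
Local Open Scope classical_set_scope.
Local Open Scope ring_scope.

(** * Reflections of Lebesgue measure *)

Section LebesgueTuple.
Variable R : realType.
Local Notation mR := (measurableTypeR R).
Local Notation leb := (@lebesgue_measure R).
Implicit Types (n : nat) (c : R).

(** By uniqueness of Lebesgue measure, half-open intervals suffice. The reflection changes which
    endpoint is included, but not the length. *)
Lemma lebesgue_measure_subl c (A : set mR) : measurable A ->
  leb ((fun x : mR => c - x : mR) @^-1` A) = leb A.
Proof.
have mf : measurable_fun setT (fun x : mR => c - x : mR).
  exact: measurable_funB.
move=> mA; rewrite -[LHS]/(pushforward leb (fun x : mR => c - x : mR) A).
apply/esym/lebesgue_measure_unique => //= _ [[a b]] _ <-.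
rewrite /pushforward.
rewrite (_ : _ @^-1` _ = [set` `[c - b, c - a[ ]); last first.
  apply/seteqP; split => x /=; rewrite !in_itv/=; lra.
rewrite !lebesgue_measure_itv/= !lte_fin ltrD2l ltrN2.
by case: ifP => // _; rewrite -!EFinB; congr (_%:E); ring.
Qed.

(* A copy of [lebesgue_tuple] that carries the sigma-finite structure required
   by the product-measure and Tonelli lemmas. *)
Definition lebesgue_tuple_sigma n : set (n.-tuple mR) -> \bar R :=
  lebesgue_tuple R n.
Arguments lebesgue_tuple_sigma : clear implicits.
HB.instance Definition _ n :=
  Measure.copy (lebesgue_tuple_sigma n) (lebesgue_tuple R n).
HB.instance Definition _ n := Measure_isSigmaFinite.Build _ _ _
  (lebesgue_tuple_sigma n) (@lebesgue_tuple_sigma_finite R n).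

Lemma measurable_preimage_cons n (A : set (n.+1.-tuple mR)) :
  measurable A -> measurable (@cons_pair R n @^-1` A).
Proof.
by move=> mA; rewrite -[X in measurable X]setTI; exact: measurable_cons_pair.
Qed.

Lemma lebesgue_tuple_xsection n (A : set (n.+1.-tuple mR)) :
  lebesgue_tuple R n.+1 A =
  (\int[lebesgue_tuple R n]_x leb (xsection (@cons_pair R n @^-1` A) x))%E.
Proof. by []. Qed.

(** The construction integrates the head coordinate innermost; uniqueness of the product measure
    allows it to be outermost instead. *)
Lemma lebesgue_tuple_ysection n (A : set (n.+1.-tuple mR)) : measurable A ->
  lebesgue_tuple R n.+1 A =
  (\int[leb]_y lebesgue_tuple R n (ysection (@cons_pair R n @^-1` A) y))%E.
Proof.
move=> mA; have mB := measurable_preimage_cons mA.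
exact: (product_measure_unique (m1 := lebesgue_tuple_sigma n) (m2 := leb)
  (m' := product_measure2 (lebesgue_tuple_sigma n) leb)
  (fun B C mB mC => product_measure2E _ _ mB mC) mB).
Qed.

(** For [c = 1] on the corner simplex, this puts the last barycentric coordinate in place of the
    [i]-th. A general [c] is what the induction on the dimension requires. *)
Definition reflect_coord n c (i : 'I_n) (x : n.-tuple mR) : n.-tuple mR :=
  [tuple if j == i then c - \sum_(k < n) tnth x k else tnth x j | j < n].

Lemma measurable_reflect_coord n c (i : 'I_n) :
  measurable_fun setT (reflect_coord c i).
Proof.
apply/measurable_fun_tnthP => j; rewrite /comp /reflect_coord.
under eq_fun do rewrite tnth_mktuple.
case: (j == i); last exact: measurable_tnth.
apply: measurable_funB => //; apply: measurable_sum => k.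
exact: measurable_tnth.
Qed.

(** Induction by slicing. If [i] is not the head, fix the head [y]: the tail is reflected with
    constant [c - y]. If [i] is the head, fix the tail: the head undergoes a one-dimensional
    reflection. *)
Lemma lebesgue_tuple_reflect n c (i : 'I_n) (A : set (n.-tuple mR)) :
  measurable A ->
  lebesgue_tuple R n (reflect_coord c i @^-1` A) = lebesgue_tuple R n A.
Proof.
elim: n c i A => [|n IH] c i A mA; first by case: i.
case: (unliftP ord0 i) => [j|] ->.
  have reflectS y x : reflect_coord c (lift ord0 j) (cons_pair (x, y)) =
      cons_pair (reflect_coord (c - y) j x, y).
    apply: eq_from_tnth => k; rewrite tnth_mktuple /cons_pair/=.
    case: (unliftP ord0 k) => [l ->|->]; last by rewrite tnth0.
    rewrite !tnthS tnth_mktuple (inj_eq lift_inj) big_ord_recl tnth0.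
    case: ifP => _ //.
    by under eq_bigr do rewrite tnthS; rewrite opprD addrA.
  rewrite [RHS]lebesgue_tuple_ysection// lebesgue_tuple_ysection; last first.
    by rewrite -[X in measurable X]setTI; exact: measurable_reflect_coord.
  apply: eq_integral => y _; rewrite -[RHS](IH (c - y) j); last first.
    by apply: measurable_ysection; exact: measurable_preimage_cons.
  congr (lebesgue_tuple R n _).
  by apply/seteqP; split => x; rewrite /= /ysection/= !inE /= reflectS.
rewrite !lebesgue_tuple_xsection; apply: eq_integral => x _.
pose c' := c - \sum_(k < n) tnth x k.
have reflect0 y : reflect_coord c ord0 (cons_pair (x, y)) =
    cons_pair (x, c' - y).
  apply: eq_from_tnth => k; rewrite tnth_mktuple /cons_pair/=.
  case: (unliftP ord0 k) => [l ->|->]; first by rewrite !tnthS.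
  rewrite !tnth0 big_ord_recl tnth0.
  under eq_bigr do rewrite tnthS.
  by rewrite /c'; ring.
rewrite -[RHS](lebesgue_measure_subl c'); last first.
  by apply: measurable_xsection; exact: measurable_preimage_cons.
congr (leb _).
by apply/seteqP; split => y; rewrite /= /xsection/= !inE /= reflect0.
Qed.

End LebesgueTuple.

(** * Integration over the simplex *)

Section PowerIntegral.
Variable R : realType.
Local Notation leb := (@lebesgue_measure R).

Lemma integral_powR_cc1 (gamma e : R) : -1 < gamma -> 0 < e < 1 ->
  (\int[leb]_(x in `[e, 1%R]) (x `^ gamma)%:E <= (gamma + 1)^-1%:E)%E.
Proof.
move=> g1 /andP[e0 e1].
have g10 : 0 < gamma + 1 by lra.
pose F (x : R) := x `^ (gamma + 1) / (gamma + 1).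
have dF (x : R) : 0 < x -> is_derive x 1 F (x `^ gamma).
  move=> x0; rewrite /F.
  have := @is_deriveZ _ _ _ _ (gamma + 1)^-1 _ _ _
    (is_derive1_powR (gamma + 1) x0).
  rewrite addrK /GRing.scale/= mulKf ?gt_eqF//.
  by congr (is_derive _ _ _ _); apply/funext => y /=; rewrite mulrC.
have cF (x : R) : 0 < x -> {for x, continuous F}.
  move=> x0; apply: differentiable_continuous; apply/derivable1_diffP.
  by have [] := dF _ x0.
have cf (x : R) : 0 < x -> {for x, continuous (fun y : R => y `^ gamma)}.
  move=> x0; apply: differentiable_continuous; apply/derivable1_diffP.
  by have [] := is_derive1_powR gamma x0.
rewrite (@continuous_FTC2 _ (fun y : R => y `^ gamma) F)//.
- rewrite -EFinB lee_fin /F powR1 -mulrBl.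
  by apply: ler_piMl; [rewrite invr_ge0 ltW|rewrite gerBl powR_ge0].
- apply: continuous_in_subspaceT => x; rewrite inE/= in_itv/= => /andP[ex _].
  by apply: cf; exact: lt_le_trans ex.
- split.
  + move=> x; rewrite in_itv/= => /andP[ex _].
    by have [] := dF _ (lt_trans e0 ex).
  + by apply: cvg_at_right_filter; exact: cF.
  + by apply: cvg_at_left_filter; apply: cF; lra.
- move=> x; rewrite in_itv/= => /andP[ex _]; rewrite derive1E.
  by apply: derive_val; apply: dF; exact: lt_trans ex.
Qed.

Lemma integral_powR01_lty (gamma : R) : -1 < gamma ->
  (\int[leb]_(x in `[0%R, 1%R]) (x `^ gamma)%:E < +oo)%E.
Proof.
move=> g1.
have mf D : measurable_fun D (fun x : R => (x `^ gamma)%:E).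
  by apply/measurable_EFinP; apply: measurable_funTS.
rewrite -integral_itv_obnd_cbnd//.
(* Monotone exhaustion of the half-open interval; starting at 1/2 keeps the lower end strictly below
   1. *)
pose F (n : nat) : set R := `[n.+2%:R^-1, 1]%classic.
have -> : `]0%R, 1%R]%classic = \bigcup_n F n.
  apply/seteqP; split => [x|x [n _]]; rewrite /F/= !in_itv/=.
    move=> /andP[x0 x1].
    exists (Num.truncn x^-1) => //=; rewrite in_itv/= x1 andbT.
    rewrite invf_ple ?posrE//.
    by rewrite (le_trans (ltW (truncnS_gt _)))// ler_nat.
  by move=> /andP[nx ->]; rewrite andbT (lt_le_trans _ nx).
apply: (@le_lt_trans _ _ (gamma + 1)^-1%:E); last exact: ltry.
have ndF : nondecreasing_seq F.
  move=> m n mn; rewrite subsetEset => x; rewrite /F/= !in_itv/=.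
  move=> /andP[mx ->]; rewrite andbT; apply: le_trans mx.
  by rewrite lef_pV2 ?posrE// ler_nat !ltnS.
have /cvg_lim <- // := @ge0_nondecreasing_set_cvg_integral
  _ (measurableTypeR R) _ F (fun x : R => (x `^ gamma)%:E) leb ndF
  (fun n => measurable_itv _)
  (fun n => mf _) (fun _ x _ => ltac:(by rewrite lee_fin powR_ge0)).
apply: lime_le.
  apply: ereal_nondecreasing_is_cvgn.
  apply: ge0_nondecreasing_set_nondecreasing_integral => //.
  + by move=> i; exact: measurable_itv.
  + by move=> i; exact: mf.
  + by move=> i x _; rewrite lee_fin powR_ge0.
apply: nearW => n; apply: integral_powR_cc1 => //.
by rewrite invr_gt0 ltr0n/= invf_lt1// ltr1n.
Qed.

End PowerIntegral.

(** * Iterated integrals on R^n *)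

Section LebesgueTupleIntegral.
Variable R : realType.
Local Notation mR := (measurableTypeR R).
Local Notation leb := (@lebesgue_measure R).

Lemma ge0_integral_lebesgue_tupleS n (f : n.+1.-tuple mR -> \bar R) :
  measurable_fun setT f -> (forall x, 0 <= f x)%E ->
  (\int[lebesgue_tuple R n.+1]_x f x =
   \int[lebesgue_tuple R n]_x \int[leb]_y f (cons_pair (x, y)))%E.
Proof.
move=> mf f0.
rewrite [LHS](ge0_integral_pushforward (@measurable_cons_pair R n) _ _ mf)//.
have mfc : measurable_fun setT (f \o @cons_pair R n).
  by apply: measurableT_comp => //; exact: measurable_cons_pair.
exact: (@fubini_tonelli1 _ _ _ _ R (@lebesgue_tuple_sigma R n) leb _ mfc
  (fun=> f0 _)).
Qed.

Lemma integral_lebesgue_tuple_prod_lty n (g : mR -> R) :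
  measurable_fun setT g -> (forall x, 0 <= g x) ->
  (\int[leb]_x (g x)%:E < +oo)%E ->
  (\int[lebesgue_tuple R n]_x (\prod_(i < n) g (tnth x i))%:E < +oo)%E.
Proof.
move=> mg g0 goo.
have mprod m : measurable_fun setT
    (fun x : m.-tuple mR => (\prod_(i < m) g (tnth x i))%:E).
  apply/measurable_EFinP; apply: measurable_prod => i _.
  by apply: measurableT_comp => //; exact: measurable_tnth.
elim: n => [|n IH].
  under eq_integral do rewrite big_ord0.
  by rewrite integral_cst//= diracT mule1 ltry.
rewrite ge0_integral_lebesgue_tupleS//; last first.
  by move=> x; rewrite lee_fin prodr_ge0.
under eq_integral => x _.
  under eq_integral => y _.
    rewrite big_ord_recl /cons_pair/= tnth0.
    under eq_bigr do rewrite tnthS.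
    rewrite mulrC EFinM; over.
  rewrite ge0_integralZl//; [|exact/measurable_EFinP| |]; last 2 first.
  - by move=> y _; rewrite lee_fin.
  - by rewrite lee_fin prodr_ge0.
  over.
rewrite ge0_integralZr//.
- have prod0 :
      (0 <= \int[lebesgue_tuple R n]_x (\prod_(i < n) g (tnth x i))%:E)%E.
    by apply: integral_ge0 => x _; rewrite lee_fin prodr_ge0.
  by apply: lte_mul_pinfty; rewrite ?ge0_fin_numE.
- exact: mprod.
- by move=> x _; rewrite lee_fin prodr_ge0.
- by apply: integral_ge0 => y _; rewrite lee_fin.
Qed.

End LebesgueTupleIntegral.

Definition permute (T : Type) n (s : 'S_n) (y : n.-tuple T) : n.-tuple T :=
  [tuple tnth y (s i) | i < n].

(** * Reflections as transpositions of barycentric coordinates *)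

Section SimplexReflection.
Variables (R : realType) (d : nat).
Local Notation mR := (measurableTypeR R).
Local Notation corner := (@corner_simplex R d).
Local Notation widen := (widen_ord (leqnSn d)).

Lemma tnth_simplex_lift_widen (x : d.-tuple R) (i : 'I_d) :
  tnth (simplex_lift x) (widen i) = tnth x i.
Proof.
rewrite /simplex_lift (tnth_nth 0) /= nth_rcons size_tuple ltn_ord.
by rewrite -tnth_nth.
Qed.

Lemma tnth_simplex_lift_max (x : d.-tuple R) :
  tnth (simplex_lift x) ord_max = 1 - \sum_(i < d) tnth x i.
Proof.
by rewrite /simplex_lift (tnth_nth 0) /= nth_rcons size_tuple ltnn eqxx.
Qed.

Lemma ord_widenP (i : 'I_d.+1) : i = ord_max \/ exists j, i = widen j.
Proof.
have [id|id] := ltnP i d.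
  by right; exists (Ordinal id); exact: val_inj.
by left; apply/val_inj/eqP; rewrite /= eqn_leq id -ltnS ltn_ord.
Qed.

Lemma measurable_simplex_lift : measurable_fun setT
  (fun x : d.-tuple mR => simplex_lift x : d.+1.-tuple mR).
Proof.
apply/measurable_fun_tnthP => i; rewrite /comp.
have [->|[j ->]] := ord_widenP i.
  under eq_fun do rewrite tnth_simplex_lift_max.
  apply: measurable_funB => //; apply: measurable_sum => k.
  exact: measurable_tnth.
under eq_fun do rewrite tnth_simplex_lift_widen.
exact: measurable_tnth.
Qed.

Lemma measurable_std_simplex :
  measurable (@std_simplex R d.+1 : set (d.+1.-tuple mR)).
Proof.
rewrite (_ : @std_simplex R d.+1 =
    [set x | forall i, `[0, +oo[%classic (tnth x i)] `&`
    (fun x : d.+1.-tuple mR => \sum_(i < d.+1) tnth x i) @^-1` [set 1]);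
    last first.
  apply/seteqP; split => x [x0 x1]; split=> // i; have /= := x0 i;
    by rewrite in_itv /= andbT.
apply: measurableI.
  apply: (@measurable_box R d.+1 (fun=> `[0, +oo[%classic)) => i.
  exact: measurable_itv.
rewrite -[X in measurable X]setTI.
apply: (_ : measurable_fun setT
  (fun x : d.+1.-tuple mR => \sum_(i < d.+1) tnth x i)) => //.
by apply: measurable_sum => k; exact: measurable_tnth.
Qed.

(** Transfers questions about the corner simplex to the standard simplex, where all coordinates play
    the same role; measurability and invariance under reflections both come from it. *)
Lemma preimage_std_simplex :
  (fun x : d.-tuple mR => simplex_lift x) @^-1` (@std_simplex R d.+1) = corner.
Proof.
apply/seteqP; split => x /= [x0 x1]; split.
- by move=> i; rewrite -tnth_simplex_lift_widen; exact: x0.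
- by have := x0 ord_max; rewrite tnth_simplex_lift_max subr_ge0.
- move=> i; have [->|[j ->]] := ord_widenP i.
    by rewrite tnth_simplex_lift_max subr_ge0.
  by rewrite tnth_simplex_lift_widen; exact: x0.
- rewrite big_ord_recr /= tnth_simplex_lift_max.
  under eq_bigr do rewrite tnth_simplex_lift_widen.
  by rewrite addrC subrK.
Qed.

Lemma measurable_corner_simplex : measurable (corner : set (d.-tuple mR)).
Proof.
rewrite -preimage_std_simplex -[X in measurable X]setTI.
by apply: measurable_simplex_lift => //; exact: measurable_std_simplex.
Qed.

(** After the reflection the coordinates sum to [1 - tnth x i], so the new last barycentric
    coordinate is the old [i]-th one. *)
Lemma simplex_lift_reflect (x : d.-tuple R) (i : 'I_d) :
  simplex_lift (reflect_coord 1 i x) =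
  permute (tperm ord_max (widen i)) (simplex_lift x).
Proof.
have sum_reflect : \sum_(k < d) tnth (reflect_coord 1 i x) k = 1 - tnth x i.
  rewrite (bigD1 i)//= tnth_mktuple eqxx [in LHS](bigD1 i)//=.
  rewrite [X in _ + X](eq_bigr (fun k => tnth x k)) => [|k /negPf ki].
    by ring.
  by rewrite tnth_mktuple ki.
apply: eq_from_tnth => j; rewrite tnth_mktuple.
have [->|[k ->]] := ord_widenP j.
  rewrite tpermL tnth_simplex_lift_max sum_reflect tnth_simplex_lift_widen.
  by ring.
rewrite tnth_simplex_lift_widen tnth_mktuple.
have [->|ki] := eqVneq k i; first by rewrite tpermR tnth_simplex_lift_max.
rewrite tpermD ?tnth_simplex_lift_widen//.
  by rewrite -val_eqE /= gtn_eqF.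
by rewrite -val_eqE /= eq_sym.
Qed.

Lemma std_simplex_permute n (s : 'S_n) (x : n.-tuple R) :
  std_simplex (permute s x) <-> std_simplex x.
Proof.
have sumE : \sum_(i < n) tnth (permute s x) i = \sum_(i < n) tnth x i.
  by under eq_bigr do rewrite tnth_mktuple; rewrite [RHS](reindex_perm s).
split=> -[x0 x1]; split; rewrite ?sumE// -?sumE// => i.
  by have := x0 (s^-1 i)%g; rewrite tnth_mktuple permKV.
by rewrite tnth_mktuple.
Qed.

Lemma preimage_reflect_corner (i : 'I_d) :
  reflect_coord 1 i @^-1` corner = corner.
Proof.
rewrite -preimage_std_simplex; apply/seteqP; split => x /=.
  by rewrite simplex_lift_reflect => /std_simplex_permute.
by rewrite simplex_lift_reflect => ?; apply/std_simplex_permute.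
Qed.

Lemma measurable_permute n (s : 'S_n) :
  measurable_fun setT (permute s : n.-tuple mR -> n.-tuple mR).
Proof.
apply/measurable_fun_tnthP => i; rewrite /comp.
under eq_fun do rewrite tnth_mktuple.
exact: measurable_tnth.
Qed.

(** Change of variables by a reflection, which preserves both the domain and the measure. For
    nonnegative [h] no integrability is involved, so this can serve to prove integrability. *)
Lemma ge0_integral_corner_tperm (h : d.+1.-tuple mR -> \bar R) (j : 'I_d.+1) :
  measurable_fun setT h -> (forall x, 0 <= h x)%E ->
  (\int[lebesgue_tuple R d]_(x in corner)
     h (permute (tperm ord_max j) (simplex_lift x)) =
   \int[lebesgue_tuple R d]_(x in corner) h (simplex_lift x))%E.
Proof.
move=> mh h0; have [->|[k ->]] := ord_widenP j.
  apply: eq_integral => x _; congr h.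
  by apply: eq_from_tnth => i; rewrite tnth_mktuple tperm1 perm1.
have mhl : measurable_fun setT (fun x : d.-tuple mR => h (simplex_lift x)).
  by apply: measurableT_comp => //; exact: measurable_simplex_lift.
under eq_integral do rewrite -simplex_lift_reflect.
rewrite -[X in (\int[_]_(x in X) _)%E](preimage_reflect_corner k).
rewrite -[LHS](ge0_integral_pushforward (measurable_reflect_coord 1 k)
  (lebesgue_tuple R d) measurable_corner_simplex (measurable_funTS mhl));
  last by move=> x _; exact: h0.
apply: eq_measure_integral => [|mref B mB _].
  exact: measurable_reflect_coord.
exact: lebesgue_tuple_reflect.
Qed.

End SimplexReflection.

(** * Integrability of the density *)

Section SimplexIntegrable.
Variables (R : realType) (d : nat) (gamma : R).
Hypothesis gamma_gt : -1 < gamma.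
Local Notation mR := (measurableTypeR R).
Local Notation leb := (@lebesgue_measure R).
Local Notation corner := (@corner_simplex R d).

Let measurable_prod_powR n (P : pred 'I_n) : measurable_fun setT
  (fun x : n.-tuple mR => \prod_(i < n | P i) tnth x i `^ gamma).
Proof.
under eq_fun do rewrite -big_filter.
apply: measurable_prod => i _.
apply: (measurableT_comp (measurable_powR gamma)).
exact: measurable_tnth.
Qed.

Lemma std_simplex_le1 n (x : n.-tuple R) i : std_simplex x -> tnth x i <= 1.
Proof.
move=> [x0 <-]; rewrite (bigD1 i)//= lerDl sumr_ge0// => j _; exact: x0.
Qed.

Lemma integral_corner_prod_widen_lty :
  (\int[lebesgue_tuple R d]_(x in corner)
     (\prod_(i < d) tnth x i `^ gamma)%:E < +oo)%E.
Proof.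
(* The corner simplex lies in the unit cube; cutting the power off outside [0, 1] turns the integral
   over the cube into one over the whole space, which factors. *)
pose g (x : mR) : R :=
  if x \in (`[0, 1]%classic : set mR) then x `^ gamma else 0.
have g0 x : 0 <= g x by rewrite /g; case: ifP => // _; exact: powR_ge0.
have gE : (fun x => (g x)%:E) = (fun x : R => (x `^ gamma)%:E) \_ `[0%R, 1%R].
  by apply/funext => x; rewrite /g patchE; case: ifP.
have mg : measurable_fun setT g.
  apply/measurable_EFinP; rewrite [X in measurable_fun _ X]gE.
  apply/(measurable_restrictT _ _).1; first exact: measurable_itv.
  apply/measurable_EFinP; exact: measurable_funTS.
have goo : (\int[leb]_x (g x)%:E < +oo)%E.
  by rewrite gE -integral_mkcond integral_powR01_lty.
apply: le_lt_trans (integral_lebesgue_tuple_prod_lty d mg g0 goo).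
rewrite integral_mkcond; apply: ge0_le_integral => //.
- move=> x _; rewrite patchE; case: ifP => // _.
  by rewrite lee_fin prodr_ge0// => i _; exact: powR_ge0.
- apply/(measurable_restrictT _ _).1; first exact: measurable_corner_simplex.
  by apply/measurable_EFinP/measurable_funTS; exact: measurable_prod_powR.
- apply/measurable_EFinP; apply: measurable_prod => i _.
  by apply: measurableT_comp => //; exact: measurable_tnth.
move=> x _; rewrite patchE; case: ifPn => [/set_mem xc|_]; last first.
  by rewrite lee_fin prodr_ge0.
rewrite lee_fin le_eqVlt; apply/orP; left; apply/eqP.
apply: eq_bigr => i _; rewrite /g mem_set//= in_itv /=.
have [x0 _] := xc; rewrite x0/= -tnth_simplex_lift_widen.
by apply: std_simplex_le1; move: xc; rewrite -preimage_std_simplex.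
Qed.

Lemma integral_corner_prod_lty (i : 'I_d.+1) :
  (\int[lebesgue_tuple R d]_(x in corner)
     (\prod_(j < d.+1 | j != i) tnth (simplex_lift x) j `^ gamma)%:E < +oo)%E.
Proof.
pose h (y : d.+1.-tuple mR) := (\prod_(j < d.+1 | j != i) tnth y j `^ gamma)%:E.
rewrite -(ge0_integral_corner_tperm (h := h) i); last 2 first.
- by apply/measurable_EFinP; exact: measurable_prod_powR.
- by move=> x; rewrite lee_fin prodr_ge0// => j _; exact: powR_ge0.
under eq_integral => x _.
  rewrite (_ : h _ = (\prod_(j < d) tnth x j `^ gamma)%:E); first over.
  rewrite /h; congr EFin.
  (* Reindexing moves the omitted factor from [i] to the last coordinate. *)
  rewrite (reindex_inj (@perm_inj _ (tperm ord_max i))) /=.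
  under eq_bigl do rewrite -[X in _ != X](tpermL ord_max i) (inj_eq perm_inj).
  under eq_bigr do rewrite tnth_mktuple tpermK.
  rewrite big_mkcond big_ord_recr /= eqxx /= mulr1.
  apply: eq_bigr => j _; rewrite tnth_simplex_lift_widen.
  by rewrite -val_eqE /= ltn_eqF.
exact: integral_corner_prod_widen_lty.
Qed.

Lemma powR_prod (I : finType) (F : I -> R) (r : R) : (forall i, 0 <= F i) ->
  (\prod_i F i) `^ r = \prod_i F i `^ r.
Proof.
move=> F0.
(* Nonnegativity of the partial products is carried along because the real power is split over
   nonnegative factors. *)
suff [] : (\prod_i F i) `^ r = \prod_i F i `^ r /\ 0 <= \prod_i F i by [].
apply: (big_rec2 (fun x y => y `^ r = x /\ 0 <= y)); first by rewrite powR1.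
by move=> i y x _ [<- x0]; rewrite powRM// mulr_ge0.
Qed.

(* One of the coordinates is at least [1 / (d + 1)], and its power is bounded
   by a constant whatever the sign of [gamma]. *)
Lemma dirichlet_density_le (y : d.+1.-tuple R) : std_simplex y ->
  (\prod_(i < d.+1) tnth y i) `^ gamma <=
  (1 + d.+1%:R^-1 `^ gamma) *
  \sum_(i < d.+1) \prod_(j < d.+1 | j != i) tnth y j `^ gamma.
Proof.
move=> ys; have [y0 y1] := ys.
have /existsP[i yi] : [exists i, d.+1%:R^-1 <= tnth y i].
  apply: contraT => /existsPn yi; have : \sum_(i < d.+1) tnth y i < 1.
    have -> : 1 = \sum_(i < d.+1) d.+1%:R^-1 :> R.
      by rewrite sumr_const card_ord -[RHS]mulr_natr mulVf.
    by apply: ltr_sum => [|i _]; [apply/hasP; exists ord0 => //;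
      exact: mem_index_enum|rewrite ltNge yi].
  by rewrite y1 ltxx.
have prod0 k : 0 <= \prod_(j < d.+1 | j != k) tnth y j `^ gamma.
  by apply: prodr_ge0 => j _; exact: powR_ge0.
rewrite powR_prod// (bigD1 i)//=.
apply: ler_pM => //; first exact: powR_ge0.
  have n0 : 0 < d.+1%:R^-1 :> R by rewrite invr_gt0.
  have yi0 : 0 < tnth y i by exact: lt_le_trans yi.
  (* For [gamma >= 0] the factor is at most 1, as the coordinate is; for [gamma < 0] the power is
     decreasing and its value at 1 / (d + 1) bounds it. The constant in the statement is the sum of
     the two bounds. *)
  have [g0|g0] := leP 0 gamma.
    apply: (@le_trans _ _ 1); last by rewrite lerDl powR_ge0.
    have -> : 1 = 1 `^ gamma :> R by rewrite powR1.
    apply: ge0_ler_powR; rewrite ?nnegrE//.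
    exact: std_simplex_le1.
  apply: (@le_trans _ _ (d.+1%:R^-1 `^ gamma)); last by rewrite lerDr.
  rewrite -[gamma]opprK !(powRN _ (- gamma)).
  rewrite lef_pV2 ?posrE ?powR_gt0//.
  by apply: ge0_ler_powR; rewrite ?nnegrE ?oppr_ge0// ltW.
by rewrite [leRHS](bigD1 i)//= lerDl sumr_ge0.
Qed.

Lemma integrable_simplex (f : d.+1.-tuple mR -> R) (C : R) :
  measurable_fun setT f -> (forall y, std_simplex y -> `|f y| <= C) ->
  (lebesgue_tuple R d).-integrable corner (fun x =>
    (f (simplex_lift x) *
     (\prod_(i < d.+1) tnth (simplex_lift x) i) `^ gamma)%:E).
Proof.
move=> mf fC.
have mcorner := @measurable_corner_simplex R d.
have mlift := @measurable_simplex_lift R d.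
pose g (x : d.-tuple mR) (i : 'I_d.+1) :=
  (\prod_(j < d.+1 | j != i) tnth (simplex_lift x) j `^ gamma)%:E.
have g0 x i : (0 <= g x i)%E.
  by rewrite lee_fin prodr_ge0// => j _; exact: powR_ge0.
pose K := C * (1 + d.+1%:R^-1 `^ gamma).
apply: (@le_integrable _ _ _ _ _ mcorner _
  (fun x => (K%:E * \sum_(i < d.+1) g x i)%E)).
- apply/measurable_EFinP/measurable_funTS; apply: measurable_funM.
    exact: measurableT_comp.
  apply: (measurableT_comp (measurable_powR gamma)).
  apply: measurable_prod => i _.
  exact: (measurableT_comp (@measurable_tnth _ _ _ i) mlift).
- move=> x xc; rewrite sumEFin -EFinM lee_fin normrM.
  have xs : std_simplex (simplex_lift x).
    by move: xc; rewrite -preimage_std_simplex.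
  have C0 : 0 <= C by exact: le_trans (fC _ xs).
  have K0 : 0 <= K by rewrite mulr_ge0// addr_ge0// powR_ge0.
  rewrite (ger0_norm K0) normrM -mulrA; apply: ler_pM => //; first exact: fC.
  rewrite ger0_norm ?powR_ge0//; apply: le_trans (dirichlet_density_le xs) _.
  by apply: ler_wpM2l; rewrite ?ler_norm// addr_ge0// powR_ge0.
- apply: integrableZl => //; apply: integrable_sum => //= i _.
  apply/integrableP; split.
    apply/measurable_EFinP/measurable_funTS.
    exact: (measurableT_comp (measurable_prod_powR _) mlift).
  under eq_integral do rewrite gee0_abs ?g0//.
  exact: integral_corner_prod_lty.
Qed.

End SimplexIntegrable.

(** Exponents are plain tuples, so that [permute] and [perm_orbit] act on exponents and on points
    alike. *)
Definition monom (R : comPzRingType) n (e : n.-tuple nat) (y : n.-tuple R) : R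
  := \prod_(i < n) tnth y i ^+ tnth e i.

Section Permute.
Local Open Scope group_scope.

Lemma permuteM T n (s t : 'S_n) (y : n.-tuple T) :
  permute s (permute t y) = permute (s * t) y.
Proof. by apply: eq_from_tnth => i; rewrite !tnth_mktuple permM. Qed.

Lemma permute1 T n (y : n.-tuple T) : permute 1 y = y.
Proof. by apply: eq_from_tnth => i; rewrite !tnth_mktuple perm1. Qed.

End Permute.

(** Trades a permutation of the exponents for one of the point, so that invariance of integrals and
    of orbits of nodes becomes symmetry in the exponents. *)
Lemma monom_permute (R : comPzRingType) n (s : 'S_n) (e : n.-tuple nat)
    (y : n.-tuple R) :
  monom (permute s e) y = monom e (permute s^-1%g y).
Proof.
rewrite /monom [RHS](reindex_perm s); apply: eq_bigr => i _.
by rewrite !tnth_mktuple permK.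
Qed.

Lemma prod_tnth_permute (R : comPzRingType) n (s : 'S_n) (y : n.-tuple R) :
  \prod_(i < n) tnth (permute s y) i = \prod_(i < n) tnth y i.
Proof.
by under eq_bigr do rewrite tnth_mktuple; rewrite [RHS](reindex_perm s).
Qed.

(** * Symmetry and linearity of the simplex integral *)

Section SimplexIntegral.
Variables (R : realType) (d : nat) (gamma : R).
Local Notation mR := (measurableTypeR R).
Local Notation corner := (@corner_simplex R d).
Implicit Types (f : d.+1.-tuple mR -> R).

(** The positive and negative parts are matched separately, whether or not their integrals are
    finite. *)
Lemma integral_corner_tperm (h : d.+1.-tuple mR -> \bar R) (j : 'I_d.+1) :
  measurable_fun setT h ->
  (\int[lebesgue_tuple R d]_(x in corner)
     h (permute (tperm ord_max j) (simplex_lift x)) =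
   \int[lebesgue_tuple R d]_(x in corner) h (simplex_lift x))%E.
Proof.
move=> mh; rewrite [LHS]integralE [RHS]integralE; congr (_ - _)%E.
- transitivity (\int[lebesgue_tuple R d]_(x in corner)
      (h^\+ (permute (tperm ord_max j) (simplex_lift x))))%E.
    by apply: eq_integral => x _; rewrite !funeposE.
  rewrite (ge0_integral_corner_tperm j (measurable_funepos mh)).
    by apply: eq_integral => x _; rewrite !funeposE.
  by move=> x; exact: funepos_ge0.
- transitivity (\int[lebesgue_tuple R d]_(x in corner)
      (h^\- (permute (tperm ord_max j) (simplex_lift x))))%E.
    by apply: eq_integral => x _; rewrite !funenegE.
  rewrite (ge0_integral_corner_tperm j (measurable_funeneg mh)).
    by apply: eq_integral => x _; rewrite !funenegE.
  by move=> x; exact: funeneg_ge0.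
Qed.

Lemma simplex_integral_tperm f (j : 'I_d.+1) : measurable_fun setT f ->
  simplex_integral gamma (f \o permute (tperm ord_max j)) =
  simplex_integral gamma f.
Proof.
move=> mf; pose F (y : d.+1.-tuple mR) : \bar R :=
  (f y * (\prod_(i < d.+1) tnth y i) `^ gamma)%:E.
have mF : measurable_fun setT F.
  apply/measurable_EFinP/measurable_funM => //.
  apply: (measurableT_comp (measurable_powR gamma)).
  by apply: measurable_prod => i _; exact: measurable_tnth.
rewrite /simplex_integral /Rintegral; apply: (congr1 fine).
rewrite -[RHS](integral_corner_tperm j mF).
apply: eq_integral => x _; rewrite /F; apply: congr1.
by rewrite prod_tnth_permute.
Qed.

Lemma simplex_integral_permute f (s : 'S_d.+1) : measurable_fun setT f ->
  simplex_integral gamma (f \o permute s) = simplex_integral gamma f.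
Proof.
(* Write [s] as a product of transpositions with the last index and induct on the number of factors;
   [f] stays general because each factor is absorbed into it. *)
have := finset.in_setT s; rewrite -(gen_tperm ord_max).
move=> /gen_prodgP[n [c cP ->]].
elim: n c cP f => [|n IH] c cP f mf.
  rewrite big_ord0; congr simplex_integral.
  by apply/funext => y /=; rewrite permute1.
rewrite big_ord_recl; have /imsetP[j _ ->] := cP ord0.
set t := (\prod_(i < n) _)%g.
have -> : f \o permute (tperm ord_max j * t)%g =
    (f \o permute (tperm ord_max j)) \o permute t.
  by apply/funext => y /=; rewrite permuteM.
rewrite IH; first exact: simplex_integral_tperm.
  by move=> i; exact: cP.
by apply: measurableT_comp => //; exact: measurable_permute.
Qed.

Definition monom_integral (e : d.+1.-tuple nat) : R :=
  simplex_integral gamma (monom e).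

Lemma measurable_monom n (e : n.-tuple nat) :
  measurable_fun setT (monom e : n.-tuple mR -> R).
Proof.
apply: measurable_prod => i _; apply: measurable_funX.
exact: measurable_tnth.
Qed.

Lemma monom_integral_permute (s : 'S_d.+1) (e : d.+1.-tuple nat) :
  monom_integral (permute s e) = monom_integral e.
Proof.
rewrite -[RHS](simplex_integral_permute s^-1%g (@measurable_monom _ e)).
by congr simplex_integral; apply/funext => y; rewrite monom_permute.
Qed.

Hypothesis gamma_gt : -1 < gamma.

(** Monomials are bounded by 1 on the simplex, hence integrable against the density. The arbitrary
    index type serves supports of polynomials, orbits of exponents and explicit combinations. *)
Lemma simplex_integral_sum (I : Type) (s : seq I) (c : I -> R)
    (e : I -> d.+1.-tuple nat) :
  simplex_integral gamma (fun y => \sum_(k <- s) c k * monom (e k) y) =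
  \sum_(k <- s) c k * monom_integral (e k).
Proof.
have int_monom k := integrable_simplex gamma_gt (@measurable_monom _ (e k))
  (C := 1).
pose F k x := (monom (e k) (simplex_lift x) *
  (\prod_(i < d.+1) tnth (simplex_lift x) i) `^ gamma).
have intF k : (lebesgue_tuple R d).-integrable corner (EFin \o F k).
  apply: int_monom => y ys.
  rewrite /monom normr_prod prodr_ile1// => i _.
  rewrite normr_ge0/= normrX exprn_ile1//.
  by rewrite ger0_norm ?std_simplex_le1//; have [+ _] := ys; exact.
have mcorner := @measurable_corner_simplex R d.
transitivity (\int[lebesgue_tuple R d]_(x in corner) \sum_(k <- s) c k * F k x).
  apply: eq_Rintegral => x _; rewrite mulr_suml.
  by apply: eq_bigr => k _; rewrite mulrA.
elim: s => [|k s IH].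
  under eq_Rintegral do rewrite big_nil.
  by rewrite big_nil /Rintegral integral0.
under eq_Rintegral do rewrite big_cons.
rewrite RintegralD//.
- by rewrite IH big_cons RintegralZl.
- rewrite [X in integrable _ _ X](_ : _ =
    fun x => ((c k)%:E * (F k x)%:E)%E)//.
  exact: (integrableZl mcorner (c k) (intF k)).
- rewrite [X in integrable _ _ X](_ : _ =
    fun x => (\sum_(k <- s) (c k)%:E * (F k x)%:E)%E).
    apply: integrable_sum => // i _.
    exact: (integrableZl mcorner (c i) (intF i)).
  by apply/funext => x /=; rewrite -sumEFin.
Qed.

Lemma simplex_weight_ge0 : 0 <= simplex_weight d gamma.
Proof.
rewrite invr_ge0; apply: Rintegral_ge0 => x _.
by rewrite mul1r powR_ge0.
Qed.

Lemma simplex_integral_ge0 f : (forall y, std_simplex y -> 0 <= f y) ->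
  0 <= simplex_integral gamma f.
Proof.
move=> f0; apply: Rintegral_ge0 => x xc; rewrite mulr_ge0 ?powR_ge0//.
by apply: f0; move: xc; rewrite -preimage_std_simplex.
Qed.

End SimplexIntegral.

(** * Sums over distinct permutations *)

Section PermSum.
Variables (R : comPzRingType) (X : Type) (T : eqType) (w : X -> T -> R).
Implicit Types (x : seq X) (s l : seq T) (z : T).

(** For the weight [a ^+ c] this is the monomial symmetric polynomial with exponents [s] evaluated
    at [x]; for the constant weight 1 it counts the distinct permutations of [s]. *)
Definition perm_sum x s : R :=
  \sum_(e <- permutations s) \prod_(q <- zip x e) w q.1 q.2.

(** Groups the distinct permutations by their first letter. For empty [s] the left side would be 1
    and the right side an empty sum. *)
Lemma perm_sum_cons a x s : (0 < size s)%N ->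
  perm_sum (a :: x) s = \sum_(c <- undup s) w a c * perm_sum x (rem c s).
Proof.
move=> s0; rewrite /perm_sum (perm_big _ (permutationsE s0)) /=.
rewrite big_allpairs_dep; apply: eq_bigr => c _; rewrite mulr_sumr.
by apply: eq_bigr => e _; rewrite big_cons.
Qed.

Lemma perm_sum_perm x s s' : perm_eq s s' -> perm_sum x s = perm_sum x s'.
Proof. by move=> /perm_permutations; exact: perm_big. Qed.

(** The first letter is either one of [l] or the padding letter. The factor [(0 < m)%:R] removes the
    second case when no padding is left, where [m.-1] is 0 by truncation. *)
Lemma perm_sum_cons_nseq a x l m z : z \notin l -> (0 < size l + m)%N ->
  perm_sum (a :: x) (l ++ nseq m z) =
  \sum_(c <- undup l) w a c * perm_sum x (rem c l ++ nseq m z)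
  + (0 < m)%:R * (w a z * perm_sum x (l ++ nseq m.-1 z)).
Proof.
move=> zl lm; rewrite perm_sum_cons ?size_cat ?size_nseq//.
have undupE : perm_eq (undup (l ++ nseq m z)) (undup l ++ nseq (0 < m) z).
  apply: uniq_perm; rewrite ?undup_uniq//.
    rewrite cat_uniq undup_uniq; case: (0 < m)%N => //=.
    by rewrite mem_undup (negPf zl).
  move=> c; rewrite mem_undup !mem_cat !mem_nseq mem_undup.
  by case: m {lm}.
rewrite (perm_big _ undupE) big_cat /=; congr (_ + _).
  rewrite 2!big_seq; apply: eq_bigr => c; rewrite mem_undup => cl.
  congr (_ * _); apply: perm_sum_perm.
  rewrite -(perm_cons c) -cat_cons.
  rewrite (permPr (_ : perm_eq ((c :: rem c l) ++ _) (l ++ nseq m z))).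
    by rewrite perm_sym perm_to_rem// mem_cat cl.
  by rewrite perm_cat2r perm_sym perm_to_rem.
case: m lm {undupE} => [|m] _; rewrite ?big_nil ?mul0r// big_seq1 mul1r/=.
congr (_ * _); apply: perm_sum_perm; rewrite -(perm_cons z).
have zlm : perm_eq (l ++ nseq m.+1 z) (z :: l ++ nseq m z).
  exact: permEl (perm_catCA l [:: z] (nseq m z)).
rewrite -(permPr zlm) perm_sym perm_to_rem//.
by rewrite mem_cat mem_head orbT.
Qed.

End PermSum.

Lemma size_permutations_rem (T : eqType) (l : seq T) : (0 < size l)%N ->
  size (permutations l) = (\sum_(c <- undup l) size (permutations (rem c l)))%N.
Proof.
move=> l0; rewrite (perm_size (permutationsE l0)) size_allpairs_dep sumnE.
by rewrite big_map.
Qed.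

(* [b] marks the positions where any letter is allowed with weight 1; at the
   other ones only the padding letter [z] has a nonzero weight. *)
Lemma perm_sum_bits (R : comPzRingType) (X T : eqType) (w : X -> T -> R)
    (b : pred X) (z : T) (x : seq X) (l : seq T) (m : nat) :
  {in x, forall a, w a z = 1 /\ forall c, c != z -> w a c = (b a)%:R} ->
  z \notin l -> size x = (size l + m)%N ->
  perm_sum w x (l ++ nseq m z) =
  ('C(count b x, size l) * size (permutations l))%:R.
Proof.
elim: x l m => [|a x IH] l m wx zl sx.
  have [-> ->] : l = [::] /\ m = 0%N by case: l m sx {zl} => [|c l] [|m].
  by rewrite /perm_sum /= big_seq1 big_nil.
have wx' : {in x, forall a, w a z = 1 /\ forall c, c != z -> w a c = (b a)%:R}.
  by move=> a' ax; apply: wx; rewrite inE ax orbT.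
have IHx l' m' := IH l' m' wx'.
have [waz wac] := wx a (mem_head _ _).
rewrite perm_sum_cons_nseq -?sx// waz mul1r.
have tail : (0 < m)%:R * perm_sum w x (l ++ nseq m.-1 z) =
    ('C(count b x, size l) * size (permutations l))%:R.
  (* Without padding, [l] has one letter more than [x], so the binomial coefficient vanishes like
     the left side. *)
  case: m sx => [|m] /= sx; last by rewrite mul1r IHx//; lia.
  by rewrite mul0r bin_small ?mul0n// (leq_ltn_trans (count_size _ _))//; lia.
rewrite tail (eq_big_seq (fun c => (b a)%:R *
  ('C(count b x, (size l).-1) * size (permutations (rem c l)))%:R)); last first.
  move=> c; rewrite mem_undup => cl.
  have cz : c != z by apply: contraNneq zl => <-.
  rewrite wac// IHx ?size_rem//; last by case: (l) cl sx => //= ? ? _; lia.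
  by apply: contra zl; exact: mem_rem.
rewrite -mulr_sumr -natr_sum -big_distrr /=.
case: l {zl sx tail IHx} => [|c l].
  by rewrite big_nil muln0 mulr0 add0r !bin0.
rewrite -size_permutations_rem// -natrM -natrD; congr (_%:R).
(* A marked position gives Pascal's rule; at an unmarked one only the padding term survives. *)
case: (b a); last by rewrite mul0n.
by rewrite mul1n add1n binS mulnDl addnC.
Qed.

(** Case of [perm_sum_bits] with weight 1 and every position marked. *)
Lemma size_permutations_nseq (T : eqType) (z : T) (l : seq T) m : z \notin l ->
  size (permutations (l ++ nseq m z)) =
  ('C(size l + m, size l) * size (permutations l))%N.
Proof.
move=> zl; pose w (_ : unit) (_ : T) : int := 1.
have := @perm_sum_bits int unit T w predT z (nseq (size l + m) tt) l m.
rewrite count_predT size_nseq => /(_ _ zl erefl) wE.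
apply/eqP; rewrite -(eqr_nat int) -wE//; apply/eqP.
rewrite /perm_sum (eq_bigr (fun=> 1)) => [|e _]; last by rewrite big1.
by rewrite big_const_seq count_predT iter_addr_0.
Qed.

(** * Orbits of tuples as lists of distinct permutations *)

Section Orbit.
Variables (T : eqType) (n : nat).
Implicit Types (y t : n.-tuple T).

Lemma mem_perm_orbit y t : (t \in perm_orbit y) = perm_eq t y.
Proof.
rewrite /perm_orbit mem_undup; apply/mapP/tuple_permP => [[s _ ->]|[s ts]].
  by exists s.
by exists s; [rewrite mem_enum|exact: val_inj].
Qed.

Lemma perm_orbit_permutations y :
  perm_eq [seq val t | t <- perm_orbit y] (permutations y).
Proof.
apply: uniq_perm.
- by rewrite (map_inj_uniq val_inj) undup_uniq.
- exact: permutations_uniq.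
move=> s; rewrite mem_permutations; apply/mapP/idP => [[t]|sy].
  by rewrite mem_perm_orbit => ty ->.
have ss : size s == n by rewrite (perm_size sy) size_tuple.
by exists (Tuple ss) => //; rewrite mem_perm_orbit.
Qed.

Lemma size_perm_orbit y : size (perm_orbit y) = size (permutations y).
Proof. by rewrite -(perm_size (perm_orbit_permutations y)) size_map. Qed.

End Orbit.

(** Names the exponent tuple that occurs inside [monsym]. *)
Definition pad n (l : seq nat) : n.-tuple nat := [tuple nth 0%N l i | i < n].

(** * Sizes of the node orbits and values of monomial symmetric polynomials at the nodes *)

Section Values.
Variable R : realType.

Lemma val_vpt n k : (k <= n)%N ->
  vpt R n k = nseq k 1 ++ nseq (n - k) 0 :> seq R.
Proof.
move=> kn; apply: (@eq_from_nth _ 0) => [|i].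
  by rewrite size_tuple size_cat !size_nseq subnKC.
rewrite size_tuple => ltin.
rewrite -(tnth_nth _ _ (Ordinal ltin)) tnth_mktuple /=.
by rewrite nth_cat size_nseq !nth_nseq; case: ltnP => //; case: ifP.
Qed.

Lemma val_upt d (a : R) p : (p <= d)%N ->
  upt d.+1 a p = a :: nseq p 1 ++ nseq (d - p) 0 :> seq R.
Proof.
move=> pd; apply: (@eq_from_nth _ 0) => [|i].
  by rewrite size_tuple /= size_cat !size_nseq subnKC.
rewrite size_tuple => ltin.
rewrite -(tnth_nth _ _ (Ordinal ltin)) tnth_mktuple /=.
case: i ltin => [|i] //= _.
by rewrite nth_cat size_nseq !nth_nseq; case: ltnP => //; case: ifP.
Qed.

Lemma val_pad n l : (size l <= n)%N ->
  pad n l = l ++ nseq (n - size l) 0%N :> seq nat.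
Proof.
move=> ln; apply: (@eq_from_nth _ 0%N) => [|i].
  by rewrite size_tuple size_cat size_nseq subnKC.
rewrite size_tuple => ltin.
rewrite -(tnth_nth _ _ (Ordinal ltin)) tnth_mktuple /=.
rewrite nth_cat nth_nseq; case: ltnP => // li.
by rewrite nth_default//; case: ifP.
Qed.

Lemma size_perm_orbit_vpt n k : (k <= n)%N ->
  size (perm_orbit (vpt R n k)) = 'C(n, k).
Proof.
move=> kn; rewrite size_perm_orbit val_vpt// size_permutations_nseq; last first.
  by rewrite mem_nseq negb_and eq_sym oner_neq0 orbT.
rewrite -[nseq k 1]cat0s size_permutations_nseq// bin0.
by rewrite cat0s size_nseq subnKC// muln1.
Qed.

(** As [a] differs from 0 and 1, a point amounts to a choice of p + 1 nonzero positions and of the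
    place of [a] among them; (p + 1) C(d + 1, p + 1) = (d + 1) C(d, p). *)
Lemma size_perm_orbit_upt d (a : R) p : a != 0 -> a != 1 -> (p <= d)%N ->
  size (perm_orbit (upt d.+1 a p)) = (d.+1 * 'C(d, p))%N.
Proof.
move=> a0 a1 pd; rewrite size_perm_orbit val_upt// -cat_cons.
rewrite size_permutations_nseq; last first.
  by rewrite inE mem_nseq negb_or eq_sym a0/= negb_and eq_sym oner_neq0 orbT.
rewrite -[a :: _]/([:: a] ++ nseq p 1) size_permutations_nseq; last first.
  by rewrite inE eq_sym.
rewrite size_cat size_nseq /= add1n bin1 mul_bin_diag muln1 mulnC.
by rewrite addSn subnKC.
Qed.

Definition monsym_at (y : seq R) (s : seq nat) : R :=
  perm_sum (fun a c => a ^+ c) y s.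

Lemma monom_zip n (e : n.-tuple nat) (y : n.-tuple R) :
  monom e y = \prod_(q <- zip y e) q.1 ^+ q.2.
Proof.
rewrite -(map_tnth_enum y) -(map_tnth_enum e) zip_map big_map big_enum /=.
by rewrite /monom.
Qed.

Lemma sum_perm_orbit_monom n (e : n.-tuple nat) (y : n.-tuple R) :
  \sum_(e' <- perm_orbit e) monom e' y = monsym_at y e.
Proof.
rewrite /monsym_at /perm_sum -(perm_big _ (perm_orbit_permutations e)).
rewrite big_map /=.
by apply: eq_bigr => e' _; rewrite monom_zip.
Qed.

Lemma monsym_at_bits (x : seq R) (l : seq nat) (m : nat) :
  {in x, forall a, a = 0 \/ a = 1} -> 0%N \notin l -> size x = (size l + m)%N ->
  monsym_at x (l ++ nseq m 0%N) =
  ('C(count_mem 1 x, size l) * size (permutations l))%:R.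
Proof.
move=> x01 l0 sx; apply: perm_sum_bits => // a /x01 [->|->]; split => // c c0.
  by rewrite expr0n (negPf c0) /= eq_sym oner_eq0.
by rewrite expr1n /= eqxx.
Qed.

Lemma monsym_at_vpt n k l : (k <= n)%N -> (size l <= n)%N -> 0%N \notin l ->
  monsym_at (vpt R n k) (pad n l) = ('C(k, size l) * size (permutations l))%:R.
Proof.
move=> kn ln l0; rewrite val_pad// monsym_at_bits//.
- rewrite val_vpt// count_cat !count_nseq /= eqxx.
  by rewrite [0 == 1]eq_sym oner_eq0 mul1n mul0n addn0.
- move=> a; rewrite val_vpt// mem_cat !mem_nseq.
  by case/orP => /andP[_ /eqP ->]; [right|left].
- by rewrite size_tuple subnKC.
Qed.

(** Split by the exponent carried by the entry [a]: a part [c] of [l], or 0. The other entries form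
    a 0/1 point, where only the number of ones matters. *)
Lemma monsym_at_upt d (a : R) p l :
  (p <= d)%N -> (0 < size l <= d.+1)%N -> 0%N \notin l ->
  monsym_at (upt d.+1 a p) (pad d.+1 l) =
  \sum_(c <- undup l)
    a ^+ c * ('C(p, (size l).-1) * size (permutations (rem c l)))%:R
  + ('C(p, size l) * size (permutations l))%:R.
Proof.
move=> pd /andP[l_gt0 ln] l0; rewrite val_pad// val_upt//.
have x01 : {in nseq p 1 ++ nseq (d - p) 0, forall a : R, a = 0 \/ a = 1}.
  move=> b; rewrite mem_cat !mem_nseq.
  by case/orP => /andP[_ /eqP ->]; [right|left].
have sx : size (nseq p 1 ++ nseq (d - p) 0 : seq R) = d.
  by rewrite size_cat !size_nseq subnKC.
have cx : count_mem 1 (nseq p 1 ++ nseq (d - p) 0 : seq R) = p.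
  rewrite count_cat !count_nseq /= eqxx.
  by rewrite [0 == 1]eq_sym oner_eq0 mul1n mul0n addn0.
rewrite [LHS]perm_sum_cons_nseq ?addn_gt0 ?l_gt0//.
congr (_ + _).
  apply: eq_big_seq => c; rewrite mem_undup => cl; congr (_ * _).
  rewrite [LHS]monsym_at_bits ?cx ?size_rem//.
    by apply: contra l0; exact: mem_rem.
  by rewrite sx; move: (size l) l_gt0 ln => r; lia.
(* If [l] fills all d + 1 positions, no exponent 0 is available for [a], and the binomial is 0
   because [p <= d]. *)
rewrite expr0 mul1r; have [dl|dl] := ltnP 0 (d.+1 - size l).
  rewrite mul1r [LHS]monsym_at_bits ?cx// sx.
  by move: (size l) l_gt0 ln dl => r; lia.
by rewrite mul0r bin_small//; move: (size l) l_gt0 ln dl => r; lia.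
Qed.

End Values.

Lemma perm_orbit_permute (T : eqType) n (s : 'S_n) (y : n.-tuple T) :
  perm_eq [seq permute s x | x <- perm_orbit y] (perm_orbit y).
Proof.
have permuteI : injective (@permute T n s).
  by apply: (can_inj (g := permute s^-1)) => x; rewrite permuteM mulVg permute1.
apply: uniq_perm; rewrite ?(map_inj_uniq permuteI) ?undup_uniq// => x.
rewrite mem_perm_orbit; apply/mapP/idP => [[z]|xy].
  rewrite mem_perm_orbit => zy ->; rewrite -(permPr zy).
  by apply/tuple_permP; exists s.
exists (permute s^-1%g x); last by rewrite permuteM mulgV permute1.
rewrite mem_perm_orbit -(permPr xy).
by apply/tuple_permP; exists s^-1%g.
Qed.

Lemma perm_eq_permute (T : eqType) n (x y : n.-tuple T) :
  perm_eq x y -> exists s : 'S_n, x = permute s y.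
Proof. by move=> /tuple_permP[s xs]; exists s; exact: val_inj. Qed.

(** * Sums over orbits of points and of exponents *)

Section Orbits.
Variables (R : realType) (n : nat).

Definition orbit_monom (y : n.-tuple R) (e : n.-tuple nat) : R :=
  \sum_(x <- perm_orbit y) monom e x.

Lemma orbit_monom_permute (s : 'S_n) y e :
  orbit_monom y (permute s e) = orbit_monom y e.
Proof.
rewrite /orbit_monom -[RHS](perm_big _ (perm_orbit_permute s^-1 y)) big_map /=.
by apply: eq_bigr => x _; exact: monom_permute.
Qed.

(** After exchanging the sums, a monomial symmetric polynomial is summed over the orbit of [y], on
    which it is constant. *)
Lemma sum_orbit_monom y e :
  \sum_(e' <- perm_orbit e) orbit_monom y e' =
  (size (perm_orbit y))%:R * monsym_at y e.
Proof.
rewrite exchange_big /= (eq_big_seq (fun=> monsym_at y e)).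
  by rewrite big_const_seq count_predT iter_addr_0 mulr_natl.
move=> x; rewrite mem_perm_orbit => /perm_eq_permute[s ->].
rewrite -sum_perm_orbit_monom -[RHS](perm_big _ (perm_orbit_permute s^-1 e)).
rewrite big_map; apply: eq_bigr => e' _.
by rewrite monom_permute invgK.
Qed.

(** Allows an equality of orbit sums to be reduced to single exponents by cancelling the orbit
    size. *)
Lemma sum_perm_orbit_symmetric (J : n.-tuple nat -> R) e :
  (forall s e', J (permute s e') = J e') ->
  \sum_(e' <- perm_orbit e) J e' = (size (perm_orbit e))%:R * J e.
Proof.
move=> Jsym; rewrite (eq_big_seq (fun=> J e)).
  by rewrite big_const_seq count_predT iter_addr_0 mulr_natl.
by move=> e'; rewrite mem_perm_orbit => /perm_eq_permute[s ->].
Qed.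

End Orbits.

(** * Partitions of 5 and monomials of degree 5 *)

Definition partitions5 : seq (seq nat) :=
  [:: [:: 5]; [:: 4; 1]; [:: 3; 2]; [:: 3; 1; 1]; [:: 2; 2; 1];
      [:: 2; 1; 1; 1]; [:: 1; 1; 1; 1; 1]]%N.

Lemma mem_partitions5 (l : seq nat) : sorted geq l -> 0%N \notin l ->
  sumn l = 5%N -> l \in partitions5.
Proof.
have sum_gt0 s a : 0%N \notin a :: s -> (0 < a)%N /\ 0%N \notin s.
  by rewrite inE negb_or lt0n eq_sym => /andP[].
case: l => [|a l] //= + /sum_gt0[a0]; case: l => [|b l] /= + .
  by move=> _ _; rewrite addn0 => ->.
move=> + /sum_gt0[b0]; case: l => [|c l] /=.
  move=> /andP[ba _] _ s5; rewrite /geq/= in ba.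
  have aE : a = (5 - b)%N by lia.
  have b2 : (b <= 2)%N by lia.
  by rewrite aE; case: b b0 b2 {ba aE s5} => [|[|[|b]]].
move=> + /sum_gt0[c0]; case: l => [|d l] /=.
  move=> /and3P[ba cb _] _ s5; rewrite /geq/= in ba cb.
  have aE : a = (4 - b)%N by lia.
  have c1 : c = 1%N by lia.
  have b2 : (b <= 2)%N by lia.
  by rewrite aE c1; case: b b0 b2 {ba cb aE s5} => [|[|[|b]]].
move=> + /sum_gt0[d0]; case: l => [|e l] /=.
  move=> /and4P[ba cb dc _] _ s5; rewrite /geq/= in ba cb dc.
  by have [-> -> -> ->] : [/\ a = 2, b = 1, c = 1 & d = 1]%N by split; lia.
move=> _ /sum_gt0[e0 l0] s5.
have [[-> -> -> -> ->] l_0] :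
    [/\ a = 1, b = 1, c = 1, d = 1 & e = 1]%N /\ sumn l = 0%N.
  by split; [split|]; lia.
case: l l0 l_0 {s5} => [|f l] // /sum_gt0[f0 _] /=; lia.
Qed.

(** Sort the nonzero exponents in decreasing order; the zeros become the padding. *)
Lemma multinom5_partition n (e : n.-tuple nat) : (5 <= n)%N ->
  (\sum_(i < n) tnth e i = 5)%N ->
  exists2 l, l \in partitions5 & perm_eq e (pad n l).
Proof.
move=> n5 e5; pose l := sort geq [seq i <- e | i != 0%N].
have pe : perm_eq e (l ++ nseq (count_mem 0%N e) 0%N).
  have := perm_filterC (fun i => i != 0%N) e; move=> /permPl; rewrite perm_sym.
  move=> /perm_trans; apply; apply: perm_cat.
    by rewrite perm_sym perm_sort.
  rewrite (_ : seq.filter _ _ = nseq (count_mem 0%N e) 0%N)//.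
  rewrite -size_filter (eq_filter (a2 := pred1 0%N)); last first.
    by move=> i /=; rewrite negbK.
  by apply/all_pred1P; exact: filter_all.
have l5 : l \in partitions5.
  apply: mem_partitions5.
  - by apply: sort_sorted => i j; exact: leq_total.
  - by rewrite mem_sort mem_filter.
  - have := perm_sumn pe; rewrite sumn_cat sumn_nseq mul0n addn0 => <-.
    by rewrite sumnE big_tuple.
exists l => //.
have le : (size l + count_mem 0%N e)%N = n.
  by have := perm_size pe; rewrite size_tuple size_cat size_nseq.
rewrite val_pad -?[in (n - _)%N]le ?addKn//.
by rewrite -[X in (_ <= X)%N]le leq_addr.
Qed.

(** * Cubature of degree 5 *)

Section Mean.
Variables (R : realType) (d : nat) (gamma : R).
Hypothesis gamma_gt : -1 < gamma.

Definition monom_mean (e : d.+1.-tuple nat) : R :=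
  simplex_weight d gamma * monom_integral gamma e.

Lemma monom_mean_permute (s : 'S_d.+1) (e : d.+1.-tuple nat) :
  monom_mean (permute s e) = monom_mean e.
Proof. by rewrite /monom_mean monom_integral_permute. Qed.

Lemma simplex_meanE (f : mpoly d.+1 R) :
  simplex_mean gamma f = \sum_(e <- msupp f) mcoeff e f * monom_mean e.
Proof.
rewrite /simplex_mean; under eq_bigr do rewrite /monom_mean mulrCA.
rewrite -mulr_sumr -(simplex_integral_sum gamma_gt); congr (_ * _).
Qed.

Lemma momentE (l : seq nat) :
  moment d gamma l = \sum_(e <- perm_orbit (pad d.+1 l)) monom_mean e.
Proof.
rewrite /moment /simplex_mean.
under [in RHS]eq_bigr do rewrite /monom_mean -[monom_integral _ _]mul1r.
rewrite -mulr_sumr -(simplex_integral_sum gamma_gt _ (fun=> 1) id).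
congr (_ * _); apply: congr1; apply/funext => y.
rewrite /monsym raddf_sum /=; apply: eq_bigr => e _.
by rewrite mevalX mul1r.
Qed.

End Mean.

Lemma monom_pad2 (R : comPzRingType) n a b (y : n.+2.-tuple R) :
  monom (pad n.+2 [:: a; b]) y =
  tnth y ord0 ^+ a * tnth y (lift ord0 ord0) ^+ b.
Proof.
rewrite /monom 2!big_ord_recl !tnth_mktuple /= mulrA big1 ?mulr1// => i _.
by rewrite tnth_mktuple nth_default ?expr0.
Qed.

Lemma perm_eq_pad n (l l' : seq nat) : (size l <= n)%N -> perm_eq l l' ->
  perm_eq (pad n l) (pad n l').
Proof.
move=> ln ll'; rewrite !val_pad -?(perm_size ll')//.
by rewrite perm_cat2r.
Qed.

Lemma moment32_le (R : realType) d (gamma : R) : (1 <= d)%N -> -1 < gamma ->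
  moment d gamma [:: 3; 2]%N <= moment d gamma [:: 4; 1]%N.
Proof.
case: d => // d _ gamma_gt; rewrite !momentE//.
rewrite !sum_perm_orbit_symmetric; try exact: monom_mean_permute.
(* Two distinct nonzero parts always give the same orbit size, so it is enough to compare one
   monomial of each type. *)
have szE a b : a != b -> a != 0%N -> b != 0%N ->
    size (perm_orbit (pad d.+2 [:: a; b])) = ('C(d.+2, 2) * 2)%N.
  move=> ab a0 b0; rewrite size_perm_orbit val_pad//.
  rewrite size_permutations_nseq; last by rewrite !inE !(eq_sym 0%N) negb_or a0.
  rewrite size_permutations; last by rewrite /= inE ab.
  by rewrite /= addnBA ?addKn.
rewrite !szE//; apply: ler_wpM2l => //.
apply: ler_wpM2l; first exact: simplex_weight_ge0.
pose I := @monom_integral R d.+1 gamma.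
have Iperm l l' : (size l <= d.+2)%N -> perm_eq l l' ->
    I (pad d.+2 l) = I (pad d.+2 l').
  move=> ln /(perm_eq_pad ln) /perm_eq_permute[s ->].
  exact: monom_integral_permute.
(* Both orders of each exponent pair enter, so that the integrand is the nonnegative symmetric
   polynomial; by symmetry its integral is twice the required difference. *)
have := simplex_integral_sum gamma_gt
  [:: (1, [:: 4; 1]%N); (1, [:: 1; 4]%N); (-1, [:: 3; 2]%N); (-1, [:: 2; 3]%N)]
  (fun q : R * seq nat => q.1) (fun q => pad d.+2 q.2).
rewrite !big_cons big_nil -!/(I _) /= (Iperm [:: 1; 4]%N [:: 4; 1]%N)//.
rewrite (Iperm [:: 2; 3]%N [:: 3; 2]%N)// => IE.
suff : 0 <= 1 * I (pad d.+2 [:: 4; 1]%N) + (1 * I (pad d.+2 [:: 4; 1]%N) +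
    (-1 * I (pad d.+2 [:: 3; 2]%N) + (-1 * I (pad d.+2 [:: 3; 2]%N) + 0))).
  by rewrite -!/(I _); lra.
rewrite -IE; apply: simplex_integral_ge0 => y [y0 _].
rewrite !big_cons big_nil /= !monom_pad2.
move: (tnth y ord0) (tnth y (lift ord0 ord0)) (y0 ord0) (y0 (lift ord0 ord0)).
move=> u v u0 v0.
rewrite (_ : _ + _ = u * v * (u + v) * (u - v) ^+ 2); last by ring.
by rewrite mulr_ge0 ?sqr_ge0// mulr_ge0 ?addr_ge0// mulr_ge0.
Qed.

Section Cubature.
Variables (R : realType) (d : nat) (gamma : R).
Hypotheses (d_ge4 : (4 <= d)%N) (gamma_gt : -1 < gamma).

Lemma rule_sumE (Q : rule R d.+1) (f : mpoly d.+1 R) :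
  rule_sum Q f =
  \sum_(e <- msupp f) mcoeff e f * \sum_(q <- Q) q.1 * monom e q.2.
Proof.
under [RHS]eq_bigr do rewrite mulr_sumr.
rewrite exchange_big; apply: eq_bigr => q _ /=.
rewrite mevalE mulr_sumr; apply: eq_bigr => e _.
by rewrite mulrCA.
Qed.

(** [J] need only match the rule in degree 5, so a single [J] serves the original rule and the
    rescaled one. *)
Lemma cubature_of_moments (Q : rule R d.+1) (J : d.+1.-tuple nat -> R) :
  (forall e : d.+1.-tuple nat, (\sum_(i < d.+1) tnth e i = 5)%N ->
    \sum_(q <- Q) q.1 * monom e q.2 = J e) ->
  (forall s e, J (permute s e) = J e) ->
  (forall l, l \in partitions5 ->
    moment d gamma l = \sum_(e <- perm_orbit (pad d.+1 l)) J e) ->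
  forall f : mpoly d.+1 R, f \is ishomog1 5 mdeg ->
  simplex_mean gamma f = rule_sum Q f.
Proof.
move=> QJ Jsym Jmoment f /dhomogP f5.
rewrite simplex_meanE// rule_sumE; apply: eq_big_seq => e /f5 e5.
have {}e5 : (\sum_(i < d.+1) tnth e i = 5)%N by rewrite -mdegE in e5 *.
congr (_ * _); rewrite QJ//.
have [l l5 /perm_eq_permute[s ->]] := multinom5_partition (n := d.+1) d_ge4 e5.
rewrite Jsym monom_mean_permute.
have := Jmoment l l5; rewrite momentE//.
rewrite !sum_perm_orbit_symmetric//; last by exact: monom_mean_permute.
(* The orbit contains the exponent itself, so its size is nonzero and cancels. *)
apply: mulfI; rewrite pnatr_eq0 -lt0n.
have := mem_perm_orbit (pad d.+1 l) (pad d.+1 l).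
by case: perm_orbit; rewrite ?perm_refl.
Qed.

End Cubature.

(** * Rules supported on orbits *)

Section OrbitRule.
Variables (R : realType) (d : nat).
Local Notation n := d.+1.

Lemma monom_tdiv (e : n.-tuple nat) (x : n.-tuple R) (c : R) :
  monom e (tdiv x c) = monom e x / c ^+ (\sum_(i < n) tnth e i).
Proof.
rewrite /monom -prodrXr -prodf_div; apply: eq_bigr => i _.
by rewrite tnth_mktuple expr_div_n.
Qed.

Lemma std_simplex_tdiv (x y : n.-tuple R) (c : R) : x \in perm_orbit y ->
  0 < c -> (forall i, 0 <= tnth y i) -> \sum_(i < n) tnth y i = c ->
  std_simplex (tdiv x c).
Proof.
rewrite mem_perm_orbit => /perm_eq_permute[s ->] c0 y0 yc; split.
  by move=> i; rewrite !tnth_mktuple divr_ge0// ltW.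
under eq_bigr do rewrite !tnth_mktuple.
rewrite -mulr_suml (_ : \sum_i _ = c) ?mulfV ?gt_eqF//.
by rewrite -yc [RHS](reindex_perm s).
Qed.

Lemma sum_vpt k : (k <= n)%N -> \sum_(i < n) tnth (vpt R n k) i = k%:R.
Proof.
move=> kn; rewrite -(big_tuple _ _ (vpt R n k) predT id) val_vpt// big_cat /=.
by rewrite !big_nseq !iter_addr_0 mul0rn addr0.
Qed.

Lemma sum_upt (a : R) p : (p <= d)%N ->
  \sum_(i < n) tnth (upt n a p) i = a + p%:R.
Proof.
move=> pd; rewrite -(big_tuple _ _ (upt n a p) predT id) val_upt//.
rewrite big_cons big_cat /= !big_nseq !iter_addr_0 mul0rn.
by rewrite addr0.
Qed.

(** The maps [t] and [t'] are the identity for the first rule and the rescalings into the simplex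
    for the second. *)
Lemma orbit_ruleE (I : finType) (B : I -> R) (v : I -> n.-tuple R)
    (t : I -> n.-tuple R -> n.-tuple R) (b : R) (u : n.-tuple R)
    (t' : n.-tuple R -> n.-tuple R) (e : n.-tuple nat) :
  \sum_(q <- [seq (B j, t j x) | j <- enum I, x <- perm_orbit (v j)] ++
             [seq (b, t' x) | x <- perm_orbit u]) q.1 * monom e q.2 =
  \sum_j B j * (\sum_(x <- perm_orbit (v j)) monom e (t j x)) +
  b * (\sum_(x <- perm_orbit u) monom e (t' x)).
Proof.
rewrite big_cat big_allpairs_dep big_map big_enum /= mulr_sumr; congr (_ + _).
by apply: eq_bigr => j _; rewrite mulr_sumr.
Qed.

(** The denominators in the weights are the orbit sizes. They cancel, leaving the value of the
    symmetric polynomial at one node per orbit, in the form of the left sides of the system. *)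
Lemma orbit_rule_moment (k : 'I_5 -> nat) (A : 'I_5 -> R) (A6 a : R) (p : nat)
    (l : seq nat) :
  (forall j, k j <= n)%N -> (p <= d)%N -> a != 0 -> a != 1 ->
  (0 < size l <= n)%N -> 0%N \notin l ->
  \sum_(e <- perm_orbit (pad n l))
    (\sum_j A j / 'C(n, k j)%:R * orbit_monom (vpt R n (k j)) e +
     A6 / (n%:R * 'C(d, p)%:R) * orbit_monom (upt n a p) e) =
  (\sum_j A j * 'C(k j, size l)%:R) * (size (permutations l))%:R +
  A6 * (\sum_(c <- undup l)
    a ^+ c * ('C(p, (size l).-1) * size (permutations (rem c l)))%:R
    + ('C(p, size l) * size (permutations l))%:R).
Proof.
move=> kn pd a0 a1 l_size l0; have /andP[_ ln] := l_size.
rewrite big_split /= exchange_big /=; congr (_ + _).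
  rewrite mulr_suml; apply: eq_bigr => j _.
  rewrite -mulr_sumr sum_orbit_monom size_perm_orbit_vpt// monsym_at_vpt//.
  rewrite mulrA mulfVK ?natrM ?mulrA// pnatr_eq0 -lt0n bin_gt0//.
rewrite -mulr_sumr sum_orbit_monom size_perm_orbit_upt// monsym_at_upt//.
rewrite natrM mulrA mulfVK// mulf_neq0// pnatr_eq0 -lt0n bin_gt0//.
Qed.

End OrbitRule.

Theorem proposition3p4 (R : realType) (d : nat) (gamma : R) (p : nat)
    (k : 'I_5 -> nat) (a A6 : R) (A : 'I_5 -> R) :
  (4 <= d)%N ->
  -1 < gamma ->
  (1 <= p <= d)%N ->
  (forall j, (1 <= k j <= d.+1)%N) ->
  injective k ->
  let m := moment d gamma in
  a = (p%:R - 1) / 2 *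
      ((m [:: 4; 1]%N - m [:: 3; 2]%N) / (m [:: 3; 1; 1]%N - m [:: 2; 2; 1]%N)) - 1 ->
  0 < a ->
  a != 1 ->
  A6 = (m [:: 4; 1]%N - m [:: 3; 2]%N) / (p%:R * a * (a - 1) ^+ 2 * (a + 1)) ->
  (forall j, 0 < A j) ->
  \sum_(j < 5) A j * (k j)%:R + A6 * (a ^+ 5 + p%:R) = m [:: 5]%N ->
  2 * (\sum_(j < 5) A j * 'C(k j, 2)%:R)
    + A6 * (a ^+ 4 * p%:R + a * p%:R + 2 * 'C(p, 2)%:R) = m [:: 4; 1]%N ->
  3 * (\sum_(j < 5) A j * 'C(k j, 3)%:R)
    + A6 * ((a ^+ 3 + 2 * a) * 'C(p, 2)%:R + 3 * 'C(p, 3)%:R)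
    = m [:: 3; 1; 1]%N ->
  4 * (\sum_(j < 5) A j * 'C(k j, 4)%:R)
    + A6 * ((a ^+ 2 + 3 * a) * 'C(p, 3)%:R + 4 * 'C(p, 4)%:R)
    = m [:: 2; 1; 1; 1]%N ->
  \sum_(j < 5) A j * 'C(k j, 5)%:R + A6 * (a * 'C(p, 4)%:R + 'C(p, 5)%:R)
    = m [:: 1; 1; 1; 1; 1]%N ->
  let lam j := A j * (k j)%:R ^+ 5 in
  let lam6 := A6 * (a + p%:R) ^+ 5 in
  let Q1 : rule R d.+1 :=
    [seq (A j / 'C(d.+1, k j)%:R, x)
      | j <- enum 'I_5, x <- perm_orbit (vpt R d.+1 (k j))] ++
    [seq (A6 / (d.+1%:R * 'C(d, p)%:R), x)
      | x <- perm_orbit (upt d.+1 a p)] in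
  let Q2 : rule R d.+1 :=
    [seq (lam j / 'C(d.+1, k j)%:R, tdiv x (k j)%:R)
      | j <- enum 'I_5, x <- perm_orbit (vpt R d.+1 (k j))] ++
    [seq (lam6 / (d.+1%:R * 'C(d, p)%:R), tdiv x (a + p%:R))
      | x <- perm_orbit (upt d.+1 a p)] in
  [/\ positive_cubature gamma 5 Q1,
      positive_cubature gamma 5 Q2
    & forall q, q \in Q2 -> std_simplex q.2].
Proof.
move=> d4 gamma_gt /andP[p0 pd] kd _ m aE a0 a1 A6E A0 E5 E41 E311 E2111 E11111.
move=> lam lam6 Q1 Q2.
have k_gt0 j : (0 < k j)%N by have /andP[] := kd j.
have k_le j : (k j <= d.+1)%N by have /andP[] := kd j.
have pR0 : 0 < p%:R :> R by rewrite ltr0n.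
have ap0 : 0 < a + p%:R by rewrite addr_gt0.
pose M := m [:: 4; 1]%N - m [:: 3; 2]%N.
pose D := m [:: 3; 1; 1]%N - m [:: 2; 2; 1]%N.
have aMD : a + 1 = (p%:R - 1) / 2 * (M / D) by rewrite {1}aE subrK.
have a1_gt0 : 0 < a + 1 by rewrite addr_gt0.
(* Division by zero gives 0, so a vanishing [M] or [D] would force [a + 1 = 0]. *)
have M0 : M != 0.
  by apply: contraTneq a1_gt0 => M0; rewrite aMD M0 mul0r mulr0 ltxx.
have D0 : D != 0.
  by apply: contraTneq a1_gt0 => D0; rewrite aMD D0 invr0 !mulr0 ltxx.
have M_gt0 : 0 < M.
  by rewrite lt0r M0 subr_ge0 moment32_le// (leq_trans _ d4).
have am1 : 0 < (a - 1) ^+ 2 by rewrite exprn_even_gt0//= subr_eq0.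
have den_gt0 : 0 < p%:R * a * (a - 1) ^+ 2 * (a + 1).
  exact: mulr_gt0 (mulr_gt0 (mulr_gt0 pR0 a0) am1) a1_gt0.
have A6_gt0 : 0 < A6 by rewrite A6E divr_gt0.
(* The factor of [A6] is the difference of the values of the (4,1) and (3,2) polynomials at [upt];
   they agree at every [vpt]. *)
have MA6 : M = A6 * (p%:R * a * (a - 1) ^+ 2 * (a + 1)).
  by rewrite A6E mulfVK// gt_eqF.
(* Obtained by eliminating [M] between the formulas for [a] and [A6]. With [binp2] the factor of
   [A6] is C(p, 2) a (a - 1)^2, the same difference for (3,1,1) and (2,2,1). *)
have DA6 : D = A6 * (p%:R - 1) / 2 * p%:R * a * (a - 1) ^+ 2.
  apply: (mulIf (lt0r_neq0 a1_gt0)); rewrite {1}aMD.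
  rewrite (_ : D * _ = (p%:R - 1) / 2 * M); last by field.
  by rewrite MA6; ring.
have binp2 : 'C(p, 2)%:R = p%:R * (p%:R - 1) / 2 :> R.
  have /(congr1 (fun i => i%:R : R)) := mul_bin_diag p 1.
  rewrite bin1 !natrM -subn1 natrB// => E2.
  by rewrite E2; field.
have binC0 j : 0 < 'C(d.+1, k j)%:R :> R by rewrite ltr0n bin_gt0.
have binCu : 0 < d.+1%:R * 'C(d, p)%:R :> R by rewrite mulr_gt0// ltr0n bin_gt0.
pose J e := \sum_j A j / 'C(d.+1, k j)%:R * orbit_monom (vpt R d.+1 (k j)) e +
     A6 / (d.+1%:R * 'C(d, p)%:R) * orbit_monom (upt d.+1 a p) e.
have Jsym s e : J (permute s e) = J e.
  rewrite /J orbit_monom_permute.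
  by under eq_bigr do rewrite orbit_monom_permute.
have J1 (e : d.+1.-tuple nat) : \sum_(q <- Q1) q.1 * monom e q.2 = J e.
  exact: (orbit_ruleE _ _ (fun=> id) _ _ id).
(* Dividing a node by c divides a monomial of degree 5 by c^5, which the factor k_j^5 or (a + p)^5
   in the weight restores. *)
have J2 (e : d.+1.-tuple nat) : (\sum_(i < d.+1) tnth e i = 5)%N ->
    \sum_(q <- Q2) q.1 * monom e q.2 = J e.
  move=> e5; rewrite [LHS](orbit_ruleE _ _ (fun j x => tdiv x (k j)%:R) _ _
    (fun x => tdiv x (a + p%:R))).
  rewrite /J /orbit_monom; congr (_ + _).
    apply: eq_bigr => j _; under eq_bigr do rewrite monom_tdiv e5.
    rewrite -mulr_suml /lam; field.
    by rewrite !gt_eqF// ltr0n.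
  under eq_bigr do rewrite monom_tdiv e5.
  rewrite -mulr_suml /lam6; field.
  rewrite (gt_eqF ap0) !andbT pnatr_eq0 -lt0n bin_gt0 pd /=.
  by rewrite addrC natr1 pnatr_eq0.
have Jmoment l : l \in partitions5 ->
    moment d gamma l = \sum_(e <- perm_orbit (pad d.+1 l)) J e.
  move=> l5.
  have /allP/(_ _ l5)/andP[/andP[l_gt0 l_le5] l0] :
    all (fun l => (0 < size l <= 5)%N && (0%N \notin l)) partitions5 by [].
  have l_size : (0 < size l <= d.+1)%N by rewrite l_gt0 (leq_trans l_le5).
  rewrite orbit_rule_moment ?(lt0r_neq0 a0)// -/m.
  (* Counts for the seven partitions and for what remains of each after one part is removed. *)
  have sizeE := (erefl : size (permutations ([::] : seq nat)) = 1%N,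
    fun i : nat => erefl : size (permutations [:: i]) = 1%N,
    erefl : size (permutations [:: 4; 1]%N) = 2%N,
    erefl : size (permutations [:: 3; 2]%N) = 2%N,
    erefl : size (permutations [:: 3; 1]%N) = 2%N,
    erefl : size (permutations [:: 2; 1]%N) = 2%N,
    erefl : size (permutations [:: 2; 2]%N) = 1%N,
    erefl : size (permutations [:: 1; 1]%N) = 1%N,
    erefl : size (permutations [:: 3; 1; 1]%N) = 3%N,
    erefl : size (permutations [:: 2; 2; 1]%N) = 3%N,
    erefl : size (permutations [:: 2; 1; 1]%N) = 3%N,
    erefl : size (permutations [:: 1; 1; 1]%N) = 1%N,
    erefl : size (permutations [:: 2; 1; 1; 1]%N) = 4%N,
    erefl : size (permutations [:: 1; 1; 1; 1]%N) = 1%N,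
    erefl : size (permutations [:: 1; 1; 1; 1; 1]%N) = 1%N).
  have m32E : m [:: 3; 2]%N = m [:: 4; 1]%N - M by rewrite /M; ring.
  have m221E : m [:: 2; 2; 1]%N = m [:: 3; 1; 1]%N - D by rewrite /D; ring.
  move: l5 {l_gt0 l_le5 l0 l_size}; rewrite !inE.
  case/predU1P => [->|].
    rewrite [undup _]/= big_seq1 [rem _ _]/= !sizeE !natrM bin0 bin1 -E5.
    by under [in RHS]eq_bigr do rewrite bin1; ring.
  case/predU1P => [->|].
    rewrite [undup _]/= !big_cons big_nil [rem _ _]/= [rem 1 _]/= !sizeE !natrM.
    by rewrite [size _]/= bin1 -E41; ring.
  case/predU1P => [->|].
    rewrite [undup _]/= !big_cons big_nil [rem _ _]/= [rem 2 _]/= !sizeE !natrM.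
    by rewrite [size _]/= bin1 m32E MA6 -E41; ring.
  case/predU1P => [->|].
    rewrite [undup _]/= !big_cons big_nil [rem _ _]/= [rem 1 _]/= !sizeE !natrM.
    by rewrite [size _]/= -E311; ring.
  case/predU1P => [->|].
    rewrite [undup _]/= !big_cons big_nil [rem _ _]/= [rem 1 _]/= !sizeE !natrM.
    by rewrite [size _]/= m221E DA6 -E311 binp2; field.
  case/predU1P => [->|/eqP ->].
    rewrite [undup _]/= !big_cons big_nil [rem _ _]/= [rem 1 _]/= !sizeE !natrM.
    by rewrite [size _]/= -E2111; ring.
  rewrite [undup _]/= big_seq1 [rem _ _]/= !sizeE !natrM.
  by rewrite [size _]/= -E11111; ring.
split.
- split; last by apply: (cubature_of_moments d4 gamma_gt _ Jsym Jmoment) => e _.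
  move=> q; rewrite mem_cat.
  case/orP => [/allpairsPdep[j [x [_ _ ->]]]|/mapP[x _ ->]];
    by rewrite divr_gt0.
- split; last exact: (cubature_of_moments d4 gamma_gt J2 Jsym Jmoment).
  move=> q; rewrite mem_cat.
  case/orP => [/allpairsPdep[j [x [_ _ ->]]]|/mapP[x _ ->]];
    rewrite divr_gt0// mulr_gt0// exprn_gt0// ltr0n//.
- move=> q; rewrite mem_cat.
  case/orP => [/allpairsPdep[j [x [_ xv ->]]]|/mapP[x xu ->]] /=.
    apply: (std_simplex_tdiv xv); rewrite ?sum_vpt// ?ltr0n// => i.
    by rewrite tnth_mktuple ler0n.
  apply: (std_simplex_tdiv xu); rewrite ?sum_upt// => i.
  by rewrite tnth_mktuple; case: ifP; rewrite ?ler0n ?ltW.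
Qed.
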